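(* Let $n=2k\ge 8$ (respectively $n=2k+1\ge 9$) and set $m=k-2$ (respectively $m=k-1$). Let $g_1,\dots,g_{2^{k-2}}$ be affine Boolean functions on $V_m$ such that (i) exactly a quarter of the $g_i$ are based on each of the blocks $A,B,C,D$, and (ii) $g_i\oplus g_j$ is balanced for all $1\le i\ne j\le 2^{k-2}$. Let $h_i=\mathbf{O}(g_i)$. For $1\le i\le 2^{k-2}$ put $P_i=g_ih_ig_i\bar h_i$, $Q_i=\bar h_ig_ih_ig_i$, $P_{i+2^{k-2}}=h_i\bar g_i\bar h_i\bar g_i$, $Q_{i+2^{k-2}}=\bar g_i\bar h_i\bar g_ih_i$ (concatenations of truth tables), and let $f$ be the Boolean function on $V_n$ whose truth table is $P_1P_2\cdots P_{2^{k-1}}\,Q_1Q_2\cdots Q_{2^{k-1}}$. Then $f$ is balanced, satisfies the SAC, has nonlinearity $N_f\ge 2^{n-1}-2^{\lfloor (n+1)/2\rfloor}$, and \[ 2^{2n+2}\le\sigma_f\le 2^{2n+2+\epsilon}, \] where $\epsilon=0$ if $n$ is even and $\epsilon=1$ if $n$ is odd.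
   Context: $V_m=\mathbb{Z}_2^m$; truth tables list values in lexicographic order of inputs and $\bar u$ denotes the bitwise complement. Let $A=0011$, $B=0101$, $C=0110$, $D=0000$. A binary string is based on $M\in\{A,B,C,D\}$ if it is a concatenation of 4-bit blocks each equal to $M$ or $\bar M$; every affine function on $V_m$ ($m\ge 2$) is based on one of these. For an affine $g$ with truth table $X_1\cdots X_{2^{m-2}}$ (4-bit blocks), $\mathbf{O}(g)=Y_1\cdots Y_{2^{m-2}}$ where $Y_1=X_1$ and, for $0\le i\le m-3$, $Y_{2^i+1}\cdots Y_{2^{i+1}}=\bar Y_1\cdots\bar Y_{2^i}$ if $X_{2^i+1}\cdots X_{2^{i+1}}=X_1\cdots X_{2^i}$, and $Y_{2^i+1}\cdots Y_{2^{i+1}}=Y_1\cdots Y_{2^i}$ if $X_{2^i+1}\cdots X_{2^{i+1}}=\bar X_1\cdots\bar X_{2^i}$. Balanced means weight equal to half the length. $\hat f=(-1)^f$, $\Delta_f(\alpha)=\sum_x\hat f(x)\hat f(x\oplus\alpha)$, $\sigma_f=\sum_{\alpha}\Delta_f(\alpha)^2$. $f$ satisfies the SAC if $\Delta_f(c)=0$ for all $c$ of Hamming weight $1$. $N_f$ is the minimum Hamming distance from $f$ to an affine function on $V_n$. *)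

(* Defs.v *)
From mathcomp Require Import all_boot all_order all_algebra.

Set Implicit Arguments.
Unset Strict Implicit.
Unset Printing Implicit Defensive.

Import GRing.Theory Num.Theory.

(* bool carries MathComp's two-element field structure (+ is xor, * is and),  *)
(* so 'rV[bool]_n is Z_2^n and Boolean functions are added pointwise mod 2.   *)
Definition V (n : nat) := 'rV[bool]_n.
Definition boolfun (n : nat) := {ffun 'rV[bool]_n -> bool}.

(* The j-th vector in lexicographic order (j < 2 ^ n): the binary expansion   *)
(* of j, coordinate 0 being the most significant bit.                         *)
Definition lexvec (n j : nat) : V n :=
  (\row_(i < n) odd (j %/ 2 ^ (n - i.+1)))%R.

Definition truth_table (n : nat) (f : boolfun n) : bitseq :=
  mkseq (fun j => f (lexvec n j)) (2 ^ n).

Definition compl (s : bitseq) : bitseq := map negb s.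

Definition blockA : bitseq := [:: false; false; true; true].
Definition blockB : bitseq := [:: false; true; false; true].
Definition blockC : bitseq := [:: false; true; true; false].
Definition blockD : bitseq := [:: false; false; false; false].

Definition based_on (M s : bitseq) : bool :=
  (4 %| size s) &&
  all [pred X : bitseq | (X == M) || (X == compl M)]
      (reshape (nseq (size s %/ 4) 4) s).

Definition is_affine (n : nat) (f : boolfun n) : bool :=
  [exists a : 'rV[bool]_n, exists c : bool,
     forall x, f x == (\sum_i a 0 i * x 0 i + c)%R].

Definition weight (n : nat) (f : boolfun n) : nat := #|[set x | f x]|.

Definition balanced (n : nat) (f : boolfun n) : Prop := 2 * weight f = 2 ^ n.

Definition dist (n : nat) (f g : boolfun n) : nat := #|[set x | f x != g x]|.

(* Minimal distance to an affine function; the zero function in the notation  *)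
(* only witnesses that affine functions exist.                                *)
Definition nonlinearity (n : nat) (f : boolfun n) : nat :=
  dist f [arg min_(l < (0%R : boolfun n) | is_affine l) dist f l]%N.

Definition vweight (n : nat) (c : V n) : nat := #|[set i | c 0%R i]|.

Definition fhat (n : nat) (f : boolfun n) (x : V n) : int := ((-1) ^+ f x)%R.

Definition autocorr (n : nat) (f : boolfun n) (alpha : V n) : int :=
  (\sum_(x : 'rV[bool]_n) fhat f x * fhat f (x + alpha))%R.

Definition sumsq (n : nat) (f : boolfun n) : int :=
  (\sum_(alpha : 'rV[bool]_n) autocorr f alpha ^+ 2)%R.

Definition SAC (n : nat) (f : boolfun n) : Prop :=
  forall c : V n, vweight c = 1 -> autocorr f c = 0%R.

(* Otab X i is Y_1 ... Y_(2^i), where the Y_j and the X_j are 4-bit blocks;   *)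
(* hence lengths are counted in units of 4 bits.  When X is the table of an   *)
(* affine function, two consecutive halves X_1 ... X_(2^i) and                *)
(* X_(2^i+1) ... X_(2^(i+1)) are either equal or complementary, so that the   *)
(* else branch is exactly the complementary case.                             *)
Fixpoint Otab (X : bitseq) (i : nat) : bitseq :=
  if i is i'.+1 then
    let Y := Otab X i' in
    let len := 4 * 2 ^ i' in
    Y ++ (if take len (drop len X) == take len X then compl Y else Y)
  else take 4 X.

(* The truth table of O(g), for g affine on V_m, m >= 2. *)
Definition O_table (m : nat) (g : boolfun m) : bitseq :=
  Otab (truth_table g) (m - 2).

Section Concatenation.

Variables (N m : nat) (g : 'I_N -> boolfun m).

Let G i := truth_table (g i).
Let H i := O_table (g i).

(* With i ranging over 'I_N: Ptab i is P_i, Ptab' i is P_(i+N), and likewise  *)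
(* for Q.                                                                     *)
Definition Ptab  i := G i ++ H i ++ G i ++ compl (H i).
Definition Ptab' i := H i ++ compl (G i) ++ compl (H i) ++ compl (G i).
Definition Qtab  i := compl (H i) ++ G i ++ H i ++ G i.
Definition Qtab' i := compl (G i) ++ compl (H i) ++ compl (G i) ++ H i.

Definition concat_table : bitseq :=
  flatten [seq Ptab i | i <- enum 'I_N] ++
  flatten [seq Ptab' i | i <- enum 'I_N] ++
  flatten [seq Qtab i | i <- enum 'I_N] ++
  flatten [seq Qtab' i | i <- enum 'I_N].

End Concatenation.

(* Main.v *)
(* Write an input of f as x = (q, p, i, u1, u2, y): q and p select one of the  *)
(* families P_i, P_(i+N), Q_i, Q_(i+N), and u1, u2 one of the four segments.   *)
(* If s y is the sum of all but the last two coordinates of y, then            *)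
(* O(g) = g + s, and with e = q + p, v1 = u1 + e, v2 = u2 + e one finds        *)
(*   f x = g_i(y) + v2 * s y + v1 * v2 + p.                                    *)
(* For fixed i and y, sums of signs over (q, p, u1, u2) are therefore explicit *)
(* (a finite check), and the remaining sum over y is a sum over an affine      *)
(* function, governed by orthogonality of characters since the linear parts    *)
(* a_i of the g_i are distinct.  Hence the autocorrelation at                  *)
(* (q, p, i, t1, t2, b) vanishes unless i = 0, t2 = q + p and                  *)
(* t1 = q + p + s b, where it is (-1)^p 2^(m+4) sum_j (-1)^(a_j . b); this     *)
(* gives sigma_f = 2^(3m+k+8) exactly.  At weight one the only nonzero         *)
(* candidates are unit vectors b in one of the last two coordinates, for which *)
(* the sum over j vanishes by the hypothesis on the blocks A, B, C, D.         *)

Require Import Defs.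
From mathcomp Require Import all_boot all_order all_algebra.
From mathcomp Require Import zify ring.
Import Order.TTheory GRing.Theory Num.Theory.

Set Implicit Arguments.
Unset Strict Implicit.
Unset Printing Implicit Defensive.

(** For fixed [i] and [y], the bits [q], [p], [v1], [v2] range freely. The linear term [p] then
    cancels the sum of all signs, so f is balanced ([quad_form_sum]). A shift changes
    [v2 * s y + v1 * v2] by a function affine in [v1], [v2], whose signs cancel unless it is
    constant; this locates the support of the autocorrelation ([autocorr_quad_form]). On it the
    values are, up to sign, 2^(m+4) times character sums over the [a_j], and Parseval
    ([sum_sqr_sum_sign_dot]) yields sigma_f, which equals the upper bound in both parities.

    For the nonlinearity, summing over the selectors ([quad_walsh]) turns a Walsh coefficient into a
    combination of full sums of the characters [a_j + v] for one vector [v]. The [a_j] being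
    distinct, at most one survives, which bounds the coefficient by 2^(m+3) ([walsh_quad_form]).

    Balancedness of [g_i + g_j] makes the [a_j] distinct; the blocks A, B, C, D encode the last two
    coordinates of [a_j] ([based_onE]), which settles the SAC ([SAC_quad_form]). [concat_tableE]
    derives the quadratic form from the truth table. *)

Lemma addbE (x y : bool) : (x + y)%R = x (+) y. Proof. by []. Qed.

Lemma sum_int_sqr (I : finType) (F : I -> int) :
  ((\sum_i F i) ^+ 2 = \sum_i \sum_j F i * F j)%R.
Proof. by rewrite expr2 big_distrlr. Qed.

(** * Inner products and character sums *)

Definition dot (n : nat) (a x : 'rV[bool]_n) : bool := (\sum_i a 0 i * x 0 i)%R.

Lemma dotDr n (a x y : 'rV[bool]_n) : dot a (x + y)%R = dot a x (+) dot a y.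
Proof.
by rewrite -addbE /dot -big_split; apply: eq_bigr => i _; rewrite mxE mulrDr.
Qed.

Lemma dotDl n (a b x : 'rV[bool]_n) : dot (a + b)%R x = dot a x (+) dot b x.
Proof.
by rewrite -addbE /dot -big_split; apply: eq_bigr => i _; rewrite mxE mulrDl.
Qed.

Lemma dot0l n (x : 'rV[bool]_n) : dot 0%R x = false.
Proof. by rewrite /dot big1 // => i _; rewrite mxE mul0r. Qed.

Lemma dot0r n (x : 'rV[bool]_n) : dot x 0%R = false.
Proof. by rewrite /dot big1 // => i _; rewrite mxE mulr0. Qed.

Lemma dot_delta n (a : 'rV[bool]_n) (j : 'I_n) : dot a (delta_mx 0%R j) = a 0%R j.
Proof.
rewrite /dot (bigD1 j) //= mxE !eqxx mulr1 big1 ?addr0 // => i /negPf ij.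
by rewrite mxE ij andbF mulr0.
Qed.

Lemma dot_row_mx m n (a x : 'rV[bool]_m) (b y : 'rV[bool]_n) :
  dot (row_mx a b) (row_mx x y) = dot a x (+) dot b y.
Proof.
rewrite -addbE /dot big_split_ord /=; congr (_ + _)%R; apply: eq_bigr => i _.
  by rewrite !row_mxEl.
by rewrite !row_mxEr.
Qed.

Lemma dot_const_mx (a x : bool) : dot (const_mx a : 'rV_1) (const_mx x) = a && x.
Proof. by rewrite /dot big_ord1 !mxE. Qed.

Lemma vecDD n (x : 'rV[bool]_n) : (x + x = 0)%R.
Proof. by apply/rowP => i; rewrite !mxE addbE addbb. Qed.

Lemma vec_addr_eq0 n (x y : 'rV[bool]_n) : (x + y == 0)%R = (x == y).
Proof.
apply/eqP/eqP => [xy0|->]; last exact: vecDD.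
by rewrite -[x]addr0 -(vecDD y) addrA xy0 add0r.
Qed.

Lemma card_vec n : #|{: 'rV[bool]_n}| = 2 ^ n.
Proof. by rewrite card_mx card_bool mul1n. Qed.

Lemma sum_sign_dot n (a : 'rV[bool]_n) :
  (\sum_x (-1) ^+ dot a x = if a == 0 then 2%:Z ^+ n else 0)%R.
Proof.
case: eqVneq => [->|/rV0Pn [j aj]].
  under eq_bigr => x _ do rewrite dot0l.
  by rewrite sumr_const card_vec expr0 natrX.
(* Translation by a unit vector on which [a] is nonzero flips every sign. *)
set S := (LHS in LHS = _); suff: (S = - S)%R by lia.
rewrite {1}/S (reindex_inj (addrI (delta_mx 0%R j))) /= -sumrN.
apply: eq_bigr => x _; rewrite dotDr dot_delta signr_addb.
by case: (a 0%R j) aj => // _; rewrite expr1 mulN1r.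
Qed.

(** * Sums over concatenated vectors *)

Lemma sum_row_mx (a b : nat) (F : 'rV[bool]_(a + b) -> int) :
  (\sum_x F x = \sum_x \sum_y F (row_mx x y))%R.
Proof.
rewrite pair_big /= (reindex (fun xy => row_mx xy.1 xy.2)) //=.
exists (fun x => (lsubmx x, rsubmx x)) => [[x y] _|x _] /=.
  by rewrite row_mxKl row_mxKr.
by rewrite hsubmxK.
Qed.

Lemma sum_const_mx (F : 'rV[bool]_1 -> int) :
  (\sum_x F x = \sum_b F (const_mx b))%R.
Proof.
rewrite (reindex (fun b : bool => const_mx b : 'rV_1)) //.
exists (fun x : 'rV[bool]_1 => x 0%R 0%R) => [b _|x _]; first by rewrite mxE.
by apply/rowP => i; rewrite mxE ord1.
Qed.

Lemma const_mx_rV1 (x : 'rV[bool]_1) : x = const_mx (x 0%R 0%R).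
Proof. by apply/rowP => i; rewrite mxE ord1. Qed.

(** Brings the four selector sums innermost, where they become a finite check for fixed [i] and
    [y]. *)
Lemma sum_exchange_bools (I J : finType)
    (F : bool -> bool -> I -> bool -> bool -> J -> int) :
  (\sum_q \sum_p \sum_i \sum_u1 \sum_u2 \sum_y F q p i u1 u2 y =
   \sum_i \sum_y \sum_q \sum_p \sum_u1 \sum_u2 F q p i u1 u2 y)%R.
Proof.
rewrite !big_bool -!big_split /=; apply: eq_bigr => i _.
by rewrite !big_bool -!big_split /=; apply: eq_bigr => y _; rewrite !big_bool.
Qed.

(** * Lexicographic order and truth tables *)

Lemma odd_div_inj n j j' : j < 2 ^ n -> j' < 2 ^ n ->
  (forall t, t < n -> odd (j %/ 2 ^ t) = odd (j' %/ 2 ^ t)) -> j = j'.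
Proof.
elim: n j j' => [|n IHn] j j'; first by rewrite expn0 !ltnS !leqn0 => /eqP-> /eqP->.
move=> jn j'n bits; have := bits 0 isT; rewrite !expn0 !divn1 => odd_jj'.
rewrite -(odd_double_half j) -(odd_double_half j') odd_jj'; congr (_ + _.*2).
rewrite -!divn2; apply: IHn => [||t tn]; rewrite ?ltn_divLR -?expnSr //.
by rewrite -!divnMA -expnS; apply: bits.
Qed.

Lemma lexvec_inj n : {in gtn (2 ^ n) &, injective (lexvec n)}.
Proof.
move=> j j' jn j'n eq_jj'; apply: (odd_div_inj jn j'n) => t tn.
have tn' : n - t.+1 < n by lia.
have /rowP/(_ (Ordinal tn')) := eq_jj'; rewrite !mxE /=.
by rewrite (_ : n - (n - t.+1).+1 = t) //; lia.
Qed.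

Lemma lexvec_bij n : bijective (fun j : 'I_(2 ^ n) => lexvec n j).
Proof.
apply: inj_card_bij => [j j' /lexvec_inj eq_jj'|]; last by rewrite card_vec card_ord.
by apply/val_inj/eq_jj'; rewrite !inE.
Qed.

Lemma truth_table_inj n : injective (@truth_table n).
Proof.
move=> f f' ff'; apply/ffunP => x; have [r rK lexK] := lexvec_bij n.
rewrite -(lexK x); have := congr1 (fun s => nth false s (r x)) ff'.
by rewrite !nth_mkseq.
Qed.

Lemma lexvec_row_mx a b i j : j < 2 ^ b ->
  lexvec (a + b) (i * 2 ^ b + j) = row_mx (lexvec a i) (lexvec b j).
Proof.
move=> jb; apply/rowP => t; rewrite !mxE; case: splitP => t' ->; rewrite mxE.
  have -> : a + b - t'.+1 = b + (a - t'.+1) by have := ltn_ord t'; lia.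
  by rewrite expnD divnMA divnMDl ?expn_gt0 // (divn_small jb) addn0.
have -> : a + b - (a + t').+1 = b - t'.+1 by lia.
(* This part contributes an even quotient, so the low bits depend on [j] alone. *)
have -> : i * 2 ^ b = i * 2 ^ t' * 2 * 2 ^ (b - t'.+1).
  by rewrite -(mulnA (i * _)) -mulnA -expnS -expnD; congr (_ * 2 ^ _);
    have := ltn_ord t'; lia.
by rewrite divnMDl ?expn_gt0 // oddD oddM andbF.
Qed.

Lemma lexvec1 (b : bool) : lexvec 1 b = const_mx b.
Proof. by apply/rowP => i; rewrite !mxE ord1; case: b. Qed.

Lemma iota_mul p q :
  iota 0 (p * q) = flatten [seq [seq i * q + j | j <- iota 0 q] | i <- iota 0 p].
Proof.
elim: p => // p IHp; rewrite mulSnr iotaD IHp -addn1 iotaD map_cat flatten_cat /=.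
by rewrite cats0 add0n -[in iota (p * q) q](addn0 (p * q)) iotaDl.
Qed.

(** Concatenation of tables at the level of functions; nesting it mirrors the layout of the table of
    f. *)
Definition bcat (a b : nat) (F : 'rV[bool]_a -> boolfun b) : boolfun (a + b) :=
  [ffun x => F (lsubmx x) (rsubmx x)].

Lemma bcatE a b (F : 'rV[bool]_a -> boolfun b) x y :
  bcat F (row_mx x y) = F x y.
Proof. by rewrite ffunE row_mxKl row_mxKr. Qed.

Lemma truth_table_bcat a b (F : 'rV[bool]_a -> boolfun b) :
  truth_table (bcat F) =
  flatten [seq truth_table (F (lexvec a i)) | i <- iota 0 (2 ^ a)].
Proof.
rewrite /truth_table /mkseq expnD iota_mul map_flatten -map_comp.
congr flatten; apply: eq_map => i; rewrite /= -map_comp; apply/eq_in_map => j.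
by rewrite mem_iota => jb; rewrite /= lexvec_row_mx ?bcatE.
Qed.

Lemma truth_table_bcat1 b (F : 'rV[bool]_1 -> boolfun b) :
  truth_table (bcat F) =
  truth_table (F (const_mx false)) ++ truth_table (F (const_mx true)).
Proof.
by rewrite truth_table_bcat -(lexvec1 false) -(lexvec1 true) /= cats0.
Qed.

Lemma compl_truth_table n (g g' : boolfun n) :
  (forall x, g' x = ~~ g x) -> compl (truth_table g) = truth_table g'.
Proof.
by move=> gg'; rewrite /compl /truth_table /mkseq -map_comp; apply: eq_map => j /=.
Qed.

(** * The operator O adds a fixed linear function *)

(** If the upper half of a prefix of [x] is the lower half plus the constant [b i], then O replaces
    that constant by its negation. Both sequences are described by these constants, which suits
    induction on the number of doublings. *)
Lemma Otab_mkseq (x h b : nat -> bool) (r L : nat) :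
  (forall j, j < 4 -> h j = x j) ->
  (forall i j, i < r -> j < 4 * 2 ^ i -> x (4 * 2 ^ i + j) = b i (+) x j) ->
  (forall i j, i < r -> j < 4 * 2 ^ i -> h (4 * 2 ^ i + j) = ~~ b i (+) h j) ->
  4 * 2 ^ r <= L ->
  Otab (mkseq x L) r = mkseq h (4 * 2 ^ r).
Proof.
move=> h0 xS hS; have take_mk s l : l <= L -> s + l <= L ->
    take l (drop s (mkseq x L)) = [seq x (s + j) | j <- iota 0 l].
  move=> lL slL; rewrite /mkseq -map_drop -map_take drop_iota take_iota add0n.
  rewrite (minn_idPl _); last by lia.
  by rewrite -[in iota s l](addn0 s) iotaDl -map_comp.
elim: r xS hS => [|r IHr] xS hS leL.
  rewrite /= -[X in take 4 X]drop0 take_mk ?add0n //.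
  by apply/eq_in_map => j; rewrite mem_iota /= => j4; rewrite h0.
have leL' : 4 * 2 ^ r * 2 <= L by rewrite -mulnA -expnSr.
cbn [Otab]; rewrite IHr; first last.
- by lia.
- by move=> i j ir; apply: hS; lia.
- by move=> i j ir; apply: xS; lia.
set l := 4 * 2 ^ r in leL' *.
have l0 : 0 < l by rewrite muln_gt0 expn_gt0.
rewrite -[X in _ == take _ X]drop0 !take_mk; try by lia.
have -> : 4 * 2 ^ r.+1 = l + l by rewrite expnS /l; lia.
have -> : ([seq x (l + j) | j <- iota 0 l] == [seq x (0 + j) | j <- iota 0 l]) = ~~ b r.
  rewrite (_ : [seq x (l + j) | j <- iota 0 l] = [seq b r (+) x j | j <- iota 0 l]).
    case: (b r); last exact/eqP/eq_map.
    (* Complementary halves already differ in their first entry, as [l] is positive. *)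
    by apply/eqP; case: (l) l0 => // l' _ [] /=; case: (x 0).
  by apply/eq_in_map => j; rewrite mem_iota => jl; apply: xS.
have iota_l : iota l l = [seq l + j | j <- iota 0 l] by rewrite -iotaDl addn0.
rewrite /mkseq iotaD map_cat add0n iota_l -map_comp.
congr cat; case br : (b r) => /=; rewrite /compl -?map_comp.
  by apply/eq_in_map => j; rewrite mem_iota => jl /=; rewrite hS // br.
by apply/eq_in_map => j; rewrite mem_iota => jl /=; rewrite hS // br.
Qed.

(** Adding 2^r to a smaller number causes no carry. *)
Lemma lexvec_add m r j : j < 2 ^ r ->
  (lexvec m (2 ^ r + j) = lexvec m (2 ^ r) + lexvec m j)%R.
Proof.
move=> jr; apply/rowP => i; rewrite !mxE; set e := m - i.+1.
case: (ltngtP e r) => [er|er|<-].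
- rewrite (_ : 2 ^ r = 2 ^ (r - e) * 2 ^ e); last by rewrite -expnD subnK // ltnW.
  by rewrite divnMDl ?expn_gt0 // mulnK ?expn_gt0 // oddD.
- have r2 : 2 ^ r.+1 <= 2 ^ e by rewrite leq_exp2l.
  rewrite expnS in r2.
  by rewrite !divn_small //; lia.
- by rewrite -{1}[2 ^ e]mul1n divnMDl ?expn_gt0 // divnn expn_gt0 oddD.
Qed.

Lemma lexvec_exp2 m r (rm : r < m) :
  lexvec m (2 ^ r) = delta_mx 0%R (rev_ord (Ordinal rm)).
Proof.
apply/rowP => i; rewrite !mxE eqxx /=.
have -> : (i == rev_ord (Ordinal rm)) = (m - i.+1 == r).
  by rewrite -val_eqE /=; have := ltn_ord i; lia.
case: (ltngtP (m - i.+1) r) => [er|er|->]; last by rewrite divnn expn_gt0.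
  by rewrite -(subnK (ltnW er)) expnD mulnK ?expn_gt0 // oddX subn_eq0 leqNgt er.
by rewrite divn_small // ltn_exp2l.
Qed.

(** Coefficient vector of the linear function [s]. *)
Definition high_ones (m : nat) : 'rV[bool]_m := (\row_(j < m) (j < m - 2)%N)%R.

Lemma O_tableE m (a : 'rV[bool]_m) (c : bool) (g h : boolfun m) : 1 < m ->
  (forall x, g x = dot a x (+) c) ->
  (forall x, h x = g x (+) dot (high_ones m) x) ->
  O_table g = truth_table h.
Proof.
move=> m1 gE hE.
have m4 : 4 * 2 ^ (m - 2) = 2 ^ m by rewrite -(expnD 2 2); congr (2 ^ _); lia.
have shift i j : j < 4 * 2 ^ i ->
   lexvec m (4 * 2 ^ i + j) = (lexvec m (4 * 2 ^ i) + lexvec m j)%R.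
  by rewrite -(expnD 2 2 i); apply: lexvec_add.
rewrite /O_table /truth_table.
rewrite (@Otab_mkseq _ (fun j => h (lexvec m j))
  (fun i => dot a (lexvec m (4 * 2 ^ i)))).
- by rewrite m4.
(* Indices below 4 affect only the last two coordinates, where [s] vanishes. *)
- move=> j j4; rewrite hE /dot big1 ?addbF // => i _; rewrite !mxE.
  case: ltnP => im; last by rewrite mul0r.
  rewrite divn_small ?mulr0 //; apply: leq_trans j4 _.
  by rewrite -[X in X <= _]/(2 ^ 2) leq_exp2l //; lia.
- by move=> i j im ji; rewrite !gE shift // dotDr addbA.
- move=> i j im ji; rewrite !hE !gE shift // !dotDr.
  have im' : 2 + i < m by lia.
  have -> : dot (high_ones m) (lexvec m (4 * 2 ^ i)) = true.
    by rewrite -(expnD 2 2 i) (lexvec_exp2 im') dot_delta mxE /=; lia.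
  by do 3!case: (dot _ _); case: (c).
- by rewrite m4.
Qed.

(** * The quadratic form of f *)

(* The value of f in terms of g = g_i(y) and s = s(y). *)
Definition quad (q p u1 u2 g s : bool) : bool :=
  g (+) (u2 (+) (q (+) p)) && s (+) (u1 (+) (q (+) p)) && (u2 (+) (q (+) p)) (+) p.

(** The coordinates are listed from most to least significant: Q against P, second against first
    half of the indices, index, segment, argument. *)
Definition pt (K m : nat) (q p : bool) (i : 'rV[bool]_K) (u1 u2 : bool)
    (y : 'rV[bool]_m) : 'rV[bool]_(1 + (1 + (K + (1 + (1 + m))))) :=
  row_mx (const_mx q) (row_mx (const_mx p)
    (row_mx i (row_mx (const_mx u1) (row_mx (const_mx u2) y)))).

Definition quad_form (K m : nat) (a : 'rV[bool]_K -> 'rV[bool]_m) c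
    (f : boolfun (1 + (1 + (K + (1 + (1 + m)))))) :=
  forall q p i u1 u2 y,
    f (pt q p i u1 u2 y) = quad q p u1 u2 (dot (a i) y (+) c i) (dot (high_ones m) y).

Lemma concat_tableE K m (g : 'I_(2 ^ K) -> boolfun m)
    (a : 'rV[bool]_K -> 'rV[bool]_m) (c : 'rV[bool]_K -> bool)
    (f : boolfun (1 + (1 + (K + (1 + (1 + m)))))) :
  1 < m ->
  (forall j x, g j x = dot (a (lexvec K j)) x (+) c (lexvec K j)) ->
  truth_table f = concat_table g -> quad_form a c f.
Proof.
move=> m1 gE f_table.
pose leaf q p i u1 u2 : boolfun m :=
  [ffun y => quad q p u1 u2 (dot (a i) y (+) c i) (dot (high_ones m) y)].
pose b (x : 'rV[bool]_1) := x 0%R 0%R.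
(* The function with the claimed formula; its table is compared with the given one segment by
   segment. *)
pose F := bcat (fun q => bcat (fun p => bcat (fun i => bcat (fun u1 => bcat (fun u2 =>
  leaf (b q) (b p) i (b u1) (b u2)))))).
suff -> : f = F.
  by move=> q p i u1 u2 y; rewrite /F /pt !bcatE /leaf ffunE /b !mxE.
apply: truth_table_inj; rewrite f_table /F !truth_table_bcat1 !truth_table_bcat.
pose h i : boolfun m := [ffun x => g i x (+) dot (high_ones m) x].
have hE i : O_table (g i) = truth_table (h i).
  by apply: (O_tableE m1 (gE i)) => x; rewrite ffunE.
have cE (k : boolfun m) : compl (truth_table k) = truth_table [ffun x => ~~ k x].
  by apply: compl_truth_table => x; rewrite ffunE.
have enumE (T : nat -> bitseq) (S : 'I_(2 ^ K) -> bitseq) : (forall i, S i = T i) ->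
    flatten [seq S i | i <- enum 'I_(2 ^ K)] = flatten [seq T i | i <- iota 0 (2 ^ K)].
  by move=> ST; rewrite -val_enum_ord -map_comp; congr flatten; apply: eq_map.
have leafE q p (i : 'I_(2 ^ K)) u1 u2 (k : boolfun m) :
    (forall x, k x = quad q p u1 u2 (g i x) (dot (high_ones m) x)) ->
    truth_table k = truth_table (leaf q p (lexvec K i) u1 u2).
  by move=> kE; congr truth_table; apply/ffunP => x; rewrite kE ffunE gE.
rewrite /concat_table -!catA.
by congr (_ ++ (_ ++ (_ ++ _))); apply: enumE => i;
  rewrite /Ptab /Ptab' /Qtab /Qtab' hE ?cE !truth_table_bcat1 -!catA;
  congr (_ ++ (_ ++ (_ ++ _))); apply: leafE => x; rewrite ?ffunE /b !mxE /quad;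
  case: (g i x); case: (dot _ _).
Qed.

Lemma pt_surj K m (x : 'rV[bool]_(1 + (1 + (K + (1 + (1 + m)))))) :
  exists q p i u1 u2 y, x = pt q p i u1 u2 y.
Proof.
rewrite -(hsubmxK x); set x1 := rsubmx x; rewrite -(hsubmxK x1).
set x2 := rsubmx x1; rewrite -(hsubmxK x2); set x3 := rsubmx x2.
rewrite -(hsubmxK x3); set x4 := rsubmx x3; rewrite -(hsubmxK x4).
rewrite (const_mx_rV1 (lsubmx x)) (const_mx_rV1 (lsubmx x1)).
rewrite (const_mx_rV1 (lsubmx x3)) (const_mx_rV1 (lsubmx x4)).
by do 6!eexists.
Qed.

Lemma pt_add K m q p i u1 u2 y q' p' i' u1' u2' y' :
  (@pt K m q p i u1 u2 y + pt q' p' i' u1' u2' y' =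
   pt (q (+) q') (p (+) p') (i + i') (u1 (+) u1') (u2 (+) u2') (y + y'))%R.
Proof.
rewrite /pt !add_row_mx; have cD b b' : (const_mx b + const_mx b' : 'rV[bool]_1)%R
    = const_mx (b (+) b') by apply/rowP => j; rewrite !mxE.
by rewrite !cD.
Qed.

Lemma dot_pt K m q p i u1 u2 y q' p' i' u1' u2' y' :
  dot (@pt K m q p i u1 u2 y) (pt q' p' i' u1' u2' y') =
  q && q' (+) (p && p' (+) (dot i i' (+) (u1 && u1' (+) (u2 && u2' (+) dot y y')))).
Proof. by rewrite /pt !dot_row_mx !dot_const_mx. Qed.

Lemma sum_pt K m (F : 'rV[bool]_(1 + (1 + (K + (1 + (1 + m))))) -> int) :
  (\sum_x F x = \sum_i \sum_y \sum_q \sum_p \sum_u1 \sum_u2 F (pt q p i u1 u2 y))%R.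
Proof.
rewrite -(sum_exchange_bools (fun q p i u1 u2 y => F (pt q p i u1 u2 y))).
rewrite sum_row_mx sum_const_mx; apply: eq_bigr => q _.
rewrite sum_row_mx sum_const_mx; apply: eq_bigr => p _.
rewrite sum_row_mx; apply: eq_bigr => i _.
rewrite sum_row_mx sum_const_mx; apply: eq_bigr => u1 _.
by rewrite sum_row_mx sum_const_mx.
Qed.

(** * Sums over the selector bits *)

Lemma quad_sum g s :
  (\sum_q \sum_p \sum_u1 \sum_u2 (-1) ^+ quad q p u1 u2 g s = 0 :> int)%R.
Proof. by rewrite !big_bool; case: g; case: s. Qed.

(** With d1, d2 the shifts of [v1], [v2], the exponent is affine in them with coefficients d2 and d1
    + [ds]; both must vanish for a nonzero sum. *)
Lemma quad_autocorr q' p' t1 t2 g g' s ds :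
  (\sum_q \sum_p \sum_u1 \sum_u2
     (-1) ^+ quad q p u1 u2 g s *
     (-1) ^+ quad (q (+) q') (p (+) p') (u1 (+) t1) (u2 (+) t2) g' (s (+) ds) =
   if (t2 == q' (+) p') && (t1 == q' (+) p' (+) ds)
   then 16%:Z * (-1) ^+ p' * (-1) ^+ (g (+) g') else 0)%R.
Proof.
rewrite !big_bool; case: g; case: g'; case: q'; case: p'; case: t1; case: t2;
  by case: s; case: ds.
Qed.

(** Summing over [v1] forces [v2 = t1], which produces [t1 && s] and a factor of absolute value 2;
    the sums over [q] and [p] contribute 4 or 0. *)
Lemma quad_walsh q' p' t1 t2 : exists2 C : int, (`|C| <= 8)%R & forall g s,
  (\sum_q \sum_p \sum_u1 \sum_u2
     (-1) ^+ (quad q p u1 u2 g s (+)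
              (q' && q (+) (p' && p (+) (t1 && u1 (+) t2 && u2)))) =
   C * (-1) ^+ (g (+) t1 && s))%R.
Proof.
exists (\sum_q \sum_p \sum_u1 \sum_u2
  (-1) ^+ (quad q p u1 u2 false false (+)
            (q' && q (+) (p' && p (+) (t1 && u1 (+) t2 && u2)))))%R.
  by rewrite !big_bool; case: q'; case: p'; case: t1; case: t2.
move=> g s; rewrite !big_bool.
by case: q'; case: p'; case: t1; case: t2; case: g; case: s.
Qed.

(** * Autocorrelation, sum of squares and Walsh coefficients *)

Section QuadForm.

Context (K m : nat) (a : 'rV[bool]_K -> 'rV[bool]_m) (c : 'rV[bool]_K -> bool).
Context (f : boolfun (1 + (1 + (K + (1 + (1 + m)))))).
Context (fE : quad_form a c f).

Lemma quad_form_sum : (\sum_x (-1) ^+ f x = 0 :> int)%R.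
Proof.
rewrite sum_pt big1 // => i _; rewrite big1 // => y _.
rewrite -[RHS](quad_sum (dot (a i) y (+) c i) (dot (high_ones m) y)).
do 4!(apply: eq_bigr => ? _); by rewrite fE.
Qed.

Context (a_inj : injective a).

Lemma autocorr_quad_form q p i t1 t2 b :
  autocorr f (pt q p i t1 t2 b) =
  (if [&& i == 0, t2 == q (+) p & t1 == q (+) p (+) dot (high_ones m) b]
   then (-1) ^+ p * 2 ^+ (m + 4) * \sum_j (-1) ^+ dot (a j) b else 0)%R.
Proof.
rewrite /autocorr sum_pt.
transitivity (\sum_j \sum_y
   if (t2 == q (+) p) && (t1 == q (+) p (+) dot (high_ones m) b)
   then 16%:Z * (-1) ^+ p * ((-1) ^+ (c j (+) c (j + i)%R (+) dot (a (j + i)%R) b)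
      * (-1) ^+ dot (a j + a (j + i))%R y) else 0)%R.
  apply: eq_bigr => j _; apply: eq_bigr => y _.
  transitivity (if (t2 == q (+) p) && (t1 == q (+) p (+) dot (high_ones m) b)
   then 16%:Z * (-1) ^+ p * (-1) ^+ ((dot (a j) y (+) c j)
      (+) (dot (a (j + i)%R) (y + b)%R (+) c (j + i)%R)) else 0)%R.
    rewrite -(@quad_autocorr q p t1 t2 _ _ (dot (high_ones m) y)).
    do 4!(apply: eq_bigr => ? _).
    by rewrite /fhat pt_add !fE (dotDr (high_ones m)).
  case: ifP => // _; congr (_ * _)%R; rewrite dotDr dotDl -signr_addb.
  by congr (_ ^+ (nat_of_bool _))%R; do 3!case: (dot _ _); case: (c j); case: (c _).
case: (_ && (t1 == _)); last by rewrite andbF big1 // => j _; rewrite big1.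
rewrite andbT.
(* Orthogonality in [y] leaves only [a j = a (j + i)], that is [i = 0]. *)
under eq_bigr => j _ do
  rewrite -mulr_sumr -mulr_sumr sum_sign_dot vec_addr_eq0 (inj_eq a_inj).
rewrite -mulr_sumr; case: eqVneq => [->|i0].
  rewrite (eq_bigr (fun j => 2 ^+ m * (-1) ^+ dot (a j) b)%R) => [|j _]; last first.
    by rewrite addr0 eqxx addbb addFb mulrC.
  by rewrite -mulr_sumr exprD; move: (_ ^+ p)%R => e; ring.
rewrite big1 ?mulr0 // => j _; rewrite ifN ?mulr0 //.
by rewrite -{1}[j]addr0 (inj_eq (addrI j)) eq_sym.
Qed.

(** Parseval: after expanding the square, the sum over [b] kills all pairs of distinct [a i],
    [a j]. *)
Lemma sum_sqr_sum_sign_dot :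
  (\sum_b (\sum_j (-1) ^+ dot (a j) b) ^+ 2 = 2 ^+ (K + m) :> int)%R.
Proof.
under eq_bigr => b _ do rewrite sum_int_sqr.
rewrite exchange_big /=; under eq_bigr => i _ do rewrite exchange_big /=.
transitivity (\sum_(i : 'rV[bool]_K) 2%:Z ^+ m)%R.
  apply: eq_bigr => i _; rewrite (bigD1 i) //= [X in (_ + X)%R]big1 ?addr0 => [|j ji].
    under eq_bigr => b _ do rewrite -signr_addb addbb.
    by rewrite sumr_const card_vec expr0 natrX.
  under eq_bigr => b _ do rewrite -signr_addb -dotDl.
  by rewrite sum_sign_dot vec_addr_eq0 (inj_eq a_inj) eq_sym (negPf ji).
by rewrite sumr_const card_vec exprD -(mulr_natl _ (2 ^ K)) natrX.
Qed.

Lemma sumsq_quad_form : sumsq f = (2 ^+ (3 * m + K + 10))%R.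
Proof.
rewrite /sumsq sum_pt (bigD1 0%R) //= [X in (_ + X)%R]big1 ?addr0 => [|i i0]; last first.
  rewrite big1 // => y _; do 4!(rewrite big1 // => ? _).
  by rewrite autocorr_quad_form (negPf i0).
(* For each [b], the four choices of [q], [p] determine [t1], [t2], giving the factor 4 times the
   square of 2^(m+4). *)
transitivity (2%:Z ^+ (2 * m + 10) * \sum_b (\sum_j (-1) ^+ dot (a j) b) ^+ 2)%R.
  rewrite mulr_sumr; apply: eq_bigr => b _; set A := (\sum_j (-1) ^+ _)%R.
  transitivity (\sum_q \sum_p \sum_t1 \sum_t2
    (if (t2 == q (+) p) && (t1 == q (+) p (+) dot (high_ones m) b)
     then (-1) ^+ p * 2 ^+ (m + 4) * A else 0) ^+ 2)%R.
    by do 4!(apply: eq_bigr => ? _); rewrite autocorr_quad_form eqxx.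
  have -> : (2%:Z ^+ (2 * m + 10) = 4 * (2 ^+ (m + 4)) ^+ 2)%R.
    by rewrite -exprM (_ : 4 = 2 ^+ 2)%R // -exprD; congr (_ ^+ _)%R; lia.
  move: (_ ^+ (m + 4))%R => M; rewrite !big_bool.
  by case: (dot _ _) => /=; ring.
by rewrite sum_sqr_sum_sign_dot -exprD; congr (_ ^+ _)%R; lia.
Qed.

Lemma walsh_quad_form l c0 :
  (`|\sum_x (-1) ^+ (f x (+) (dot l x (+) c0)) : int| <= 2 ^+ (m + 3))%R.
Proof.
have [q [p [i [t1 [t2 [b ->]]]]]] := pt_surj l.
have [C C8 CE] := quad_walsh q p t1 t2.
(* The frequency in [y], with the term [t1 && s] from [quad_walsh] absorbed. *)
pose v := (b + (if t1 then high_ones m else 0))%R.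
rewrite sum_pt.
have -> : (\sum_j \sum_y \sum_q' \sum_p' \sum_u1 \sum_u2 (-1) ^+
     (f (pt q' p' j u1 u2 y) (+) (dot (pt q p i t1 t2 b) (pt q' p' j u1 u2 y) (+) c0))
   = \sum_j \sum_y C * (-1) ^+ (c j (+) dot i j (+) c0) * (-1) ^+ dot (a j + v) y)%R.
  apply: eq_bigr => j _; apply: eq_bigr => y _.
  transitivity ((-1) ^+ (dot i j (+) c0 (+) dot b y) *
    (C * (-1) ^+ ((dot (a j) y (+) c j) (+) t1 && dot (high_ones m) y)))%R.
    rewrite -CE; do 4!(rewrite mulr_sumr; apply: eq_bigr => ? _).
    rewrite fE dot_pt -signr_addb; congr (_ ^+ (nat_of_bool _))%R.
    move: (quad _ _ _ _ _ _) (q && _) (p && _) (t1 && _) (t2 && _).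
    by do 5!case; case: (dot i j); case: (dot b y); case: (c0).
  rewrite mulrCA -mulrA -!signr_addb; congr (_ * _ ^+ (nat_of_bool _))%R.
  rewrite /v !dotDl; case: (t1); rewrite ?dot0l /=.
    by do 4!case: (dot _ _); case: (c0); case: (c j).
  by do 3!case: (dot _ _); case: (c0); case: (c j).
under eq_bigr => j _ do rewrite -mulr_sumr sum_sign_dot vec_addr_eq0.
apply: le_trans (ler_norm_sum _ _ _) _.
apply: (@le_trans _ _ (\sum_j if a j == v then 8 * 2%:Z ^+ m else 0)%R).
  apply: ler_sum => j _; case: ifP => _; last by rewrite mulr0 normr0.
  by rewrite !normrM normr_sign mulr1 normrX ler_pM // exprn_ge0.
rewrite exprD mulrC; case: (pickP (fun j => a j == v)) => [j /eqP <-|av].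
  rewrite (bigD1 j) //= eqxx big1 ?addr0 // => j' /negPf jj'.
  by rewrite (inj_eq a_inj) jj'.
by rewrite big1 => [|j _]; rewrite ?av // mulr_ge0 // exprn_ge0.
Qed.

End QuadForm.

(** * From sign sums to weights, distances and the SAC *)

Lemma sum_sign (T : finType) (b : T -> bool) :
  (\sum_x (-1) ^+ b x = #|T|%:Z - 2 * #|[set x | b x]|%:Z)%R.
Proof.
have -> : (#|T|%:Z = \sum_(x : T) 1)%R by rewrite sumr_const natz.
have -> : (#|[set x | b x]|%:Z = \sum_x (b x)%:Z)%R.
  rewrite (bigID b) /= [X in (_ + X)%R]big1 ?addr0 => [|x /negPf -> //].
  by rewrite (eq_bigr (fun=> 1%R)) => [|x -> //]; rewrite sumr_const natz cardsE.
by rewrite mulr_sumr -sumrB; apply: eq_bigr => x _; case: (b x).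
Qed.

Lemma affineP n (l : boolfun n) :
  reflect (exists a c, forall x, l x = dot a x (+) c) (is_affine l).
Proof.
apply: (iffP existsP) => [[a /existsP [c /forallP lE]]|[a [c lE]]].
  by exists a, c => x; apply/eqP/lE.
by exists a; apply/existsP; exists c; apply/forallP => x; apply/eqP/lE.
Qed.

Lemma vweightE n (x : 'rV[bool]_n) : vweight x = \sum_i x 0%R i.
Proof.
rewrite /vweight -sum1_card big_mkcond; apply: eq_bigr => i _.
by rewrite inE; case: (x _ i).
Qed.

Lemma vweight_row_mx m n (x : 'rV[bool]_m) (y : 'rV[bool]_n) :
  vweight (row_mx x y) = vweight x + vweight y.
Proof.
rewrite !vweightE big_split_ord /=; congr (_ + _); apply: eq_bigr => i _.
  by rewrite row_mxEl.
by rewrite row_mxEr.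
Qed.

Lemma vweight_const_mx (b : bool) : vweight (const_mx b : 'rV_1) = b.
Proof. by rewrite vweightE big_ord1 mxE. Qed.

Lemma vweight0 n (x : 'rV[bool]_n) : vweight x = 0 -> x = 0%R.
Proof.
move/cards0_eq/setP => x0; apply/rowP => i; rewrite mxE.
by have := x0 i; rewrite !inE.
Qed.

Lemma vweight_delta n (x : 'rV[bool]_n) :
  vweight x = 1 -> exists j, x = delta_mx 0%R j.
Proof.
move/eqP/cards1P => [j /setP xj]; exists j; apply/rowP => i; rewrite mxE.
by have := xj i; rewrite !inE eqxx => ->; case: eqP.
Qed.

Lemma balanced_sum n (f : boolfun n) :
  balanced f <-> (\sum_x (-1) ^+ f x = 0 :> int)%R.
Proof. by rewrite sum_sign card_vec /balanced /weight; lia. Qed.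

Lemma dist_ge n (f : boolfun n) (l : boolfun n) d :
  (`|\sum_x (-1) ^+ (f x (+) l x) : int| <= (2 ^ d.+1)%:Z)%R ->
  2 ^ (n - 1) - 2 ^ d <= dist f l.
Proof.
rewrite sum_sign card_vec (_ : [set x | f x (+) l x] = [set x | f x != l x]); last first.
  by apply/setP => x; rewrite !inE; case: (f x); case: (l x).
rewrite -/(dist f l) expnS; case: n f l => [|n] f l.
  (* For [n = 0] the truncated subtraction gives 0. *)
  by move=> _; rewrite sub0n expn0 (@leq_trans 0) // leqn0 subn_eq0 expn_gt0.
by rewrite subn1 expnS ler_norml /= => /andP [_]; lia.
Qed.

Lemma SAC_quad_form K m a c f : @quad_form K m a c f -> injective a ->
  (forall j : 'I_m, m - 2 <= j -> (\sum_i (-1) ^+ a i 0 j = 0 :> int)%R) ->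
  SAC f.
Proof.
move=> fE a_inj a_low x; have [q [p [i [t1 [t2 [b ->]]]]]] := pt_surj x.
rewrite /pt !vweight_row_mx !vweight_const_mx (autocorr_quad_form fE a_inj).
case: eqVneq => //= -> x1; case: eqP => //= t2E; case: eqP => //= t1E.
(* If [q] or [p] is set, then either both are, or [t2] is set too; the weight exceeds 1. *)
have q0 : q = false by move: x1; rewrite t2E; case: (q); case: (p) => //=; lia.
have p0 : p = false by move: x1; rewrite t2E; case: (q); case: (p) => //=; lia.
move: t1E x1; rewrite t2E q0 p0 /= => ->.
(* If [s b] is 1, then [t1] uses up the whole weight, so [b = 0], a contradiction. *)
case b1 : (dot _ b) => /= x1.
  have b0 : b = 0%R by apply: vweight0; lia.
  by rewrite b0 dot0r in b1.
have [j bj] : exists j, b = delta_mx 0%R j.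
  by apply: vweight_delta; move: x1; rewrite vweightE big1 // => j; rewrite mxE.
move: b1; rewrite bj dot_delta mxE => /negbT; rewrite -leqNgt => jm.
by under eq_bigr => i' _ do rewrite dot_delta; rewrite a_low // mulr0.
Qed.

(** * The block hypothesis and the last two coefficients *)

(** The first block shows the increments of [g] along the last two unit vectors, and these are
    unchanged by complementing the block. *)
Lemma based_onE m M (g : boolfun m) (a : 'rV[bool]_m) c :
  1 < m -> size M = 4 -> (forall x, g x = dot a x (+) c) ->
  based_on M (truth_table g) ->
  forall e, e < 2 -> dot a (lexvec m (2 ^ e)) = nth false M 0 (+) nth false M (2 ^ e).
Proof.
move=> m1 M4 gE /andP [_]; rewrite size_mkseq.
have m4 : 2 ^ m = 4 * (2 ^ (m - 2)) by rewrite -(expnD 2 2); congr (2 ^ _); lia.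
have m0 : 0 < 2 ^ (m - 2) by rewrite expn_gt0.
rewrite m4 mulKn // -(prednK m0) /= => /andP [gM _] e e2.
have e4 : 2 ^ e < 4 by case: e e2 => [|[]].
have gn j : j < 4 -> nth false (take 4 (truth_table g)) j = g (lexvec m j).
  by move=> j4; rewrite nth_take // nth_mkseq //; lia.
have gd : dot a (lexvec m (2 ^ e)) = g (lexvec m 0) (+) g (lexvec m (2 ^ e)).
  have -> : lexvec m 0 = 0%R by apply/rowP => i; rewrite !mxE div0n.
  by rewrite !gE dot0r addFb; case: (c); case: (dot _ _).
rewrite gd -!gn //; case/orP: gM => /eqP ->; rewrite // /compl.
by rewrite !(nth_map false) ?M4 // addbN addNb negbK.
Qed.

(** Four fibres partition [I], so if each has at least a quarter, each has exactly a quarter. A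
    lower bound is assumed because [based_onE] yields an inclusion. *)
Lemma sum_sign_code (I : finType) (code : I -> bool * bool) :
  (forall x, #|I| <= 4 * #|[set i | code i == x]|) ->
  (\sum_i (-1) ^+ (code i).1 = 0 :> int)%R /\ (\sum_i (-1) ^+ (code i).2 = 0 :> int)%R.
Proof.
move=> codeI; have sumE (F : bool * bool -> int) :
    (\sum_i F (code i) = \sum_x \sum_y F (x, y) * #|[set i | code i == (x, y)]|%:Z)%R.
  rewrite pair_big /= (partition_big code predT) //=; apply: eq_bigr => -[x y] _ /=.
  rewrite (eq_bigr (fun=> F (x, y))) => [|i /eqP -> //].
  by rewrite sumr_const -mulr_natr natz cardsE.
have := sumE (fun=> 1%R); rewrite sumr_const natz (_ : #|_| = #|I|) //.
rewrite (sumE (fun x => (-1) ^+ x.1)%R) (sumE (fun x => (-1) ^+ x.2)%R).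
rewrite !big_bool /= ?expr0 ?expr1.
have := codeI (true, true); have := codeI (true, false).
have := codeI (false, true); have := codeI (false, false).
rewrite !mulN1r !mul1r; move: #|I| #|[set i | code i == (true, true)]|
  #|[set i | code i == (true, false)]| #|[set i | code i == (false, true)]|
  #|[set i | code i == (false, false)]|.
by split; lia.
Qed.

Theorem theorem2 (n k m : nat)
    (hnkm : [/\ n = 2 * k, 8 <= n & m = k - 2] \/
            [/\ n = 2 * k + 1, 9 <= n & m = k - 1])
    (g : 'I_(2 ^ (k - 2)) -> boolfun m)
    (g_affine : forall i, is_affine (g i))
    (g_quarter : forall M : bitseq, M \in [:: blockA; blockB; blockC; blockD] ->
       4 * #|[set i | based_on M (truth_table (g i))]| = 2 ^ (k - 2))
    (g_balanced : forall i j, i != j -> balanced (g i + g j)%R)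
    (f : boolfun n)
    (f_table : truth_table f = concat_table g) :
  [/\ balanced f,
      SAC f,
      2 ^ (n - 1) - 2 ^ ((n + 1) %/ 2) <= nonlinearity f
    & (2 ^+ (2 * n + 2) <= sumsq f <= 2 ^+ (2 * n + 2 + odd n))%R].
Proof.
set K := k - 2 in g g_affine g_quarter g_balanced f_table.
have nE : n = 1 + (1 + (K + (1 + (1 + m)))) by rewrite /K; case: hnkm => -[]; lia.
have m1 : 1 < m by case: hnkm => -[]; lia.
have half_n : (n + 1) %/ 2 = m + 2 by case: hnkm => -[]; lia.
have sumsq_exp : 2 * n + 2 <= 3 * m + K + 10 <= 2 * n + 2 + odd n.
  by rewrite /K; case: hnkm => -[]; lia.
rewrite half_n {half_n}; move: sumsq_exp; clear hnkm; subst n => sumsq_exp.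
have /fin_all_exists [a /fin_all_exists [c gE]] :
    forall j, exists a c, forall x, g j x = dot a x (+) c.
  by move=> j; apply/affineP.
have [r rK lexK] := lexvec_bij K.
pose av i := a (r i); pose cv i := c (r i).
have gvE j x : g j x = dot (av (lexvec K j)) x (+) cv (lexvec K j).
  by rewrite gE /av /cv rK.
have fE : quad_form av cv f := concat_tableE m1 gvE f_table.
have av_inj : injective av.
  (* Equal linear parts would make the sum of two of the [g] constant, hence unbalanced. *)
  move=> i i' aii'; apply: (can_inj lexK); apply/eqP/negPn/negP => /g_balanced.
  move/balanced_sum; under eq_bigr => x _.
    rewrite ffunE addbE !gE -/(av i) -/(av i') aii' addbACA addbb addFb; over.
  by rewrite sumr_const card_vec => /eqP; rewrite mulrn_eq0 expn_eq0 signr_eq0.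
have av_low (j : 'I_m) : m - 2 <= j -> (\sum_i (-1) ^+ av i 0 j = 0 :> int)%R.
  move=> jm; pose code j := (dot (a j) (lexvec m (2 ^ 0)), dot (a j) (lexvec m (2 ^ 1))).
  have [|s0 s1] := @sum_sign_code _ code.
    move=> x; rewrite card_ord.
    (* The four blocks realise the four codes, one each. *)
    have [M MM xM] : exists2 M, M \in [:: blockA; blockB; blockC; blockD] &
        x = (nth false M 0 (+) nth false M 1, nth false M 0 (+) nth false M 2).
      case: x => [[] []].
      - by exists blockC.
      - by exists blockB.
      - by exists blockA.
      - by exists blockD.
    have M4 : size M = 4 by move: MM; rewrite !inE => /or4P [] /eqP ->.
    apply: leq_trans (eq_leq (esym (g_quarter M MM))) _.
    rewrite leq_mul2l /=; apply/subset_leq_card/subsetP => i.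
    rewrite !inE => /(based_onE m1 M4 (gE i)) aM.
    by rewrite /code !aM // xM.
  rewrite (reindex (fun j : 'I_(2 ^ K) => lexvec K j)) /=; last first.
    exact/onW_bij/lexvec_bij.
  have jE : j = rev_ord (Ordinal m1) \/ j = rev_ord (Ordinal (ltnW m1)).
    by case: (eqVneq (j : nat) (m - 2)) => j2; [left|right]; apply: val_inj => /=;
      have := ltn_ord j; lia.
  case: jE => ->.
    rewrite -[RHS]s1; apply: eq_bigr => i _.
    by rewrite /code /= lexvec_exp2 dot_delta /av rK.
  rewrite -[RHS]s0; apply: eq_bigr => i _.
  by rewrite /code /= (lexvec_exp2 (ltnW m1)) dot_delta /av rK.
split.
- exact/balanced_sum/(quad_form_sum fE).
- exact: SAC_quad_form fE av_inj av_low.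
- rewrite /nonlinearity; case: arg_minnP => [|l /affineP [b [c0 lE]] _].
    by apply/affineP; exists 0%R, false => x; rewrite dot0l ffunE.
  apply: dist_ge; rewrite -addnS.
  under eq_bigr => x _ do rewrite lE.
  by apply: le_trans (walsh_quad_form fE av_inj b c0) _; rewrite -natrX natz.
- by rewrite (sumsq_quad_form fE av_inj) !ler_eXn2l.
Qed.
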